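(* Let $\mathbf{C}\in\mathcal{S}^n$, $\mathbf{b}\in\mathbb{R}^m$, $\varepsilon>0$, let $\mathcal{A}:\mathcal{S}^n\to\mathbb{R}^m$ be a linear map with adjoint $\mathcal{A}^*:\mathbb{R}^m\to\mathcal{S}^n$, and let $\Omega:=\{X\in\mathcal{S}^n:\mathcal{A}(X)=\mathbf{b},\ X\succeq0\}$. Assume that $\Omega$ is compact, that there exists $X_0\in\Omega$ with $X_0\succ0$, and that $\mathcal{A}^*\lambda=0$ implies $\lambda=0$. Then the problem $$\mathbf{Q}_\varepsilon:\quad\rho_\varepsilon=\min_{X\in\mathcal{S}^n}\{\,\mathrm{Tr}(\mathbf{C}\cdot X)+\varepsilon\,\mathrm{Tr}(X\cdot\ln(X)):\ \mathcal{A}(X)=\mathbf{b},\ X\succeq0\,\}$$ has a unique optimal solution $X^*(\varepsilon)\in\Omega$, it satisfies $X^*(\varepsilon)\succ0$, and $$\rho_\varepsilon=\mathrm{Tr}(\mathbf{C}\cdot X^*(\varepsilon))+\varepsilon\,\mathrm{Tr}(X^*(\varepsilon)\cdot\ln(X^*(\varepsilon)))=\max_{\lambda\in\mathbb{R}^m}G_\varepsilon(\lambda)=\mathbf{b}^T\lambda^*-\varepsilon\,\mathrm{Tr}(X^*(\varepsilon)),$$ where the maximum of $G_\varepsilon$ over $\mathbb{R}^m$ is attained and $\lambda^*\in\mathbb{R}^m$ denotes a maximizer.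
   Context: $\mathcal{S}^n$ is the space of real symmetric $n\times n$ matrices with inner product $\langle X,Y\rangle=\mathrm{Tr}(X\cdot Y)$; $\mathbb{R}^m$ carries the standard inner product, and $\mathcal{A}^*$ is the adjoint of $\mathcal{A}$ for these inner products. For $X\succeq0$ with eigenvalues $\sigma_1,\ldots,\sigma_n$, $\mathrm{Tr}(X\cdot\ln(X)):=\sum_{i=1}^n\sigma_i\ln(\sigma_i)$ with the convention $0\ln 0=0$. The dual function is $$G_\varepsilon(\lambda):=\mathbf{b}^T\lambda+\inf_{X\succeq0}\{\mathrm{Tr}(X\cdot(\mathbf{C}-\mathcal{A}^*\lambda))+\varepsilon\,\mathrm{Tr}(X\cdot\ln(X))\}=\mathbf{b}^T\lambda-\varepsilon\,\mathrm{Tr}\big(\exp((\mathcal{A}^*\lambda-\mathbf{C})/\varepsilon-\mathbf{I})\big),\qquad\lambda\in\mathbb{R}^m,$$ where $\exp$ is the matrix exponential and $\mathbf{I}$ is the identity matrix. *)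

(* Defs.v *)
From HB Require Import structures.
From mathcomp Require Export all_boot all_order all_algebra.
From mathcomp Require Export all_classical all_reals all_analysis.

Set Implicit Arguments.
Unset Strict Implicit.
Unset Printing Implicit Defensive.
Import Order.TTheory GRing.Theory Num.Theory.
Import numFieldNormedType.Exports.

Local Open Scope classical_set_scope.
Local Open Scope ring_scope.

Record symmx (R : realType) (n : nat) := SymMx {
  symmx_val :> 'M[R]_n;
  _ : symmx_val \is symmetricmx }.

HB.instance Definition _ (R : realType) (n : nat) :=
  [isSub for @symmx_val R n].
HB.instance Definition _ (R : realType) (n : nat) :=
  [Choice of symmx R n by <:].

Lemma symmetricmx_submod_closed (R : realType) (n : nat) :
  submod_closed (fun X : 'M[R]_n => X \is symmetricmx).
Proof.
have symE (M : 'M[R]_n) :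
    (M \in (fun X : 'M[R]_n => X \is symmetricmx)) = (M^T == M).
  have -> : (M^T == M) = (M \is symmetricmx).
    by rewrite is_hermitianmxE expr0 scale1r map_mx_id // eq_sym.
  by [].
split=> [|a X Y]; rewrite !symE ?trmx0 // => /eqP XT /eqP YT.
by rewrite linearD linearZ /= XT YT.
Qed.

HB.instance Definition _ (R : realType) (n : nat) :=
  GRing.SubChoice_isSubLmodule.Build R 'M[R]_n
    (fun X : 'M[R]_n => X \is symmetricmx) (symmx R n)
    (GRing.submod_closed_semi (@symmetricmx_submod_closed R n)).

HB.instance Definition _ (R : realType) (n : nat) :=
  Topological.copy (symmx R n) (initial_topology (@symmx_val R n)).

Definition psd (R : realType) (n : nat) : set (symmx R n) :=
  [set X | forall v : 'cV[R]_n, 0 <= (v^T *m X *m v) 0 0].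

Definition pd (R : realType) (n : nat) : set (symmx R n) :=
  [set X | forall v : 'cV[R]_n, v != 0 -> 0 < (v^T *m X *m v) 0 0].

Definition symdot (R : realType) (n : nat) (X Y : symmx R n) : R :=
  \tr (X *m Y).

Definition vecdot (R : realType) (m : nat) (u v : 'cV[R]_m) : R :=
  (u^T *m v) 0 0.

Definition is_adjoint (R : realType) (n m : nat)
    (A : symmx R n -> 'cV[R]_m) (As : 'cV[R]_m -> symmx R n) : Prop :=
  forall X l, vecdot (A X) l = symdot X (As l).

(* The eigenvalues listed with multiplicity, in an unspecified order. The
   default [::] is never used: the characteristic polynomial of a real
   symmetric matrix splits. *)
Definition eigenvalues (R : realType) (n : nat) (X : symmx R n) : seq R :=
  xget [::] [set s | char_poly X = \prod_(x <- s) ('X - x%:P)].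

(* Tr (X ln X); a zero eigenvalue contributes 0 * ln 0 = 0. *)
Definition tr_xlnx (R : realType) (n : nat) (X : symmx R n) : R :=
  \sum_(s <- eigenvalues X) s * ln s.

Definition feasible (R : realType) (n m : nat) (A : symmx R n -> 'cV[R]_m)
    (b : 'cV[R]_m) : set (symmx R n) :=
  [set X | A X = b /\ psd X].

Definition objective (R : realType) (n : nat) (C : symmx R n) (eps : R)
    (X : symmx R n) : R :=
  symdot C X + eps * tr_xlnx X.

Definition optimal_value (R : realType) (n m : nat) (C : symmx R n)
    (A : symmx R n -> 'cV[R]_m) (b : 'cV[R]_m) (eps : R) : \bar R :=
  ereal_inf [set (objective C eps X)%:E | X in feasible A b].

Definition optimal_solution (R : realType) (n m : nat) (C : symmx R n)
    (A : symmx R n -> 'cV[R]_m) (b : 'cV[R]_m) (eps : R) (X : symmx R n) :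
    Prop :=
  feasible A b X /\
  forall Y, feasible A b Y -> objective C eps X <= objective C eps Y.

(* Extended-real valued, so that the infimum needs no finiteness proof. *)
Definition dual_function (R : realType) (n m : nat) (C : symmx R n)
    (As : 'cV[R]_m -> symmx R n) (b : 'cV[R]_m) (eps : R) (l : 'cV[R]_m) :
    \bar R :=
  ((vecdot b l)%:E +
   ereal_inf [set (symdot X (C - As l) + eps * tr_xlnx X)%:E
             | X in @psd R n])%E.

Definition maximizer (R : realType) (T : Type) (f : T -> \bar R) (x : T) :
    Prop :=
  forall y, (f y <= f x)%E.

(* Main.v *)
(* The proof goes through the dual. For symmetric X >= 0 and Y, expanding traces
   in eigenbases u_i of X and v_j of Y reduces Klein's inequality
     Tr (X ln X) >= Tr (X Y) - Tr (exp (Y - I))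
   to the scalar Young inequality s ln s - s x + exp (x - 1) >= 0, summed
   against the doubly stochastic weights <u_i, v_j>^2; equality forces
   X = exp (Y - I). Hence the infimum defining G l is attained exactly at
   P l = exp ((As l - C) / eps - I), and b - A (P l) is a supergradient of G
   at l. The strictly feasible point and the injectivity of As make G coercive,
   so it has a maximizer; continuity of l |-> P l then gives A (P l) = b there.
   Weak duality makes P l optimal, and the equality case of Klein's inequality
   makes it the only optimal solution. *)
Require Import Defs.
From mathcomp Require Import spectral complex ring lra.
Import Order.TTheory GRing.Theory Num.Theory.
Import numFieldNormedType.Exports.
Local Open Scope classical_set_scope.
Local Open Scope ring_scope.

Set Implicit Arguments.
Unset Strict Implicit.
Unset Printing Implicit Defensive.

(** * Spectral theorem for real symmetric matrices *)

Lemma mx11_eq (R : pzSemiRingType) (A B : 'M[R]_1) : A 0 0 = B 0 0 -> A = B.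
Proof. by move=> AB; rewrite (mx11_scalar A) (mx11_scalar B) AB. Qed.

Lemma mulmx_tr_sqr (R : pzRingType) n m (W : 'M[R]_(n, m)) i :
  (W *m W^T) i i = \sum_j W i j ^+ 2.
Proof. by rewrite mxE; apply: eq_bigr => j _; rewrite mxE expr2. Qed.

(** Over the complex numbers [X] becomes Hermitian, so its spectral diagonal is real and its first
    entry is the image of some real [a]. Being an eigenvalue descends along the field embedding,
    which gives a real eigenvector to normalise. *)
Lemma symmetric_eigenvector (R : realType) n (X : 'M[R]_n.+1) : X^T = X ->
  exists a, exists2 v : 'rV_n.+1, v *m X = a *: v & v *m v^T = 1%:M.
Proof.
move=> XT; pose f := real_complex R; pose A := map_mx f X.
have Aherm : A \is hermsymmx.
  apply: realsym_hermsym.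
    apply/is_hermitianmxP; rewrite expr0 scale1r map_mx_id //.
    by rewrite /A map_trmx XT.
  by apply/mxOverP => i j; rewrite !mxE; apply/complex_realP; exists (X i j).
have /mxOverP/(_ 0 0)/complex_realP[a Ea] := hermitian_spectral_diag_real Aherm.
have /eigenvalueP[v /eqP vX v0] : eigenvalue X a.
  rewrite -(eigenvalue_map f); apply/eigenvalueP.
  exists (row 0 (spectralmx A)).
    have /orthomx_spectralP AE := hermitian_normalmx Aherm.
    rewrite -row_mul [X in _ *m X]AE !mulmxA mulmxV ?spectral_unit // mul1mx.
    by rewrite row_mul row_diag_mx -scalemxAl -rowE Ea.
  apply/eqP => r0; have := mulmxV (spectral_unit A).
  move=> /(congr1 (row 0)); rewrite row_mul r0 mul0mx => /rowP/(_ 0).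
  by rewrite !mxE => /eqP; rewrite eq_sym oner_eq0.
have nv : 0 < (v *m v^T) 0 0.
  rewrite mulmx_tr_sqr lt_def sumr_ge0 ?andbT => [|i _]; last exact: sqr_ge0.
  apply: contra v0; rewrite psumr_eq0 => [/allP vi0|i _]; last exact: sqr_ge0.
  apply/eqP/rowP => i; rewrite mxE; apply/eqP.
  by have := vi0 i (mem_index_enum i); rewrite /= sqrf_eq0.
pose s := Num.sqrt ((v *m v^T) 0 0).
have s2 : s * s = (v *m v^T) 0 0 by rewrite -expr2 sqr_sqrtr // ltW.
have s0 : s != 0 by rewrite gt_eqF // sqrtr_gt0.
exists a, (s^-1 *: v); first by rewrite -scalemxAl (eqP vX) !scalerA mulrC.
rewrite linearZ /= -scalemxAl -scalemxAr; apply: mx11_eq.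
by rewrite 2!mxE -s2 mxE mulrA -expr2 -exprMn mulVf // expr1n.
Qed.

(* The Householder reflection exchanging the first basis vector and [v]. *)
Lemma unit_row_complete (R : realFieldType) n (v : 'rV[R]_n.+1) :
  v *m v^T = 1%:M ->
  exists2 Q : 'M[R]_n.+1, Q *m Q^T = 1%:M & row 0 Q = v.
Proof.
move=> v1; pose e : 'rV[R]_n.+1 := delta_mx 0 0.
have [-> | ve] := eqVneq v e.
  by exists 1%:M; rewrite ?trmx1 ?mulmx1 // row1.
pose w := v - e; pose c := (w *m w^T) 0 0.
have ee : e *m e^T = 1%:M.
  rewrite trmx_delta mul_delta_mx; apply: mx11_eq. by rewrite !mxE.
(* Since [v] and [e] are unit vectors, [c = 2 - 2 <e, v>], while [<e, w> = <e, v> - 1]. *)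
have ew : (e *m w^T) 0 0 = - (c / 2).
  have vE : v = w + e by rewrite subrK.
  have ewT : (w *m e^T) 0 0 = (e *m w^T) 0 0.
rewrite -[in RHS](trmxK e) -trmx_mul. by rewrite [RHS]mxE.
  move: v1; rewrite vE linearD /= mulmxDl !mulmxDr ee => /matrixP/(_ 0 0).
  have addE (A B : 'M[R]_1) : (A + B) 0 0 = A 0 0 + B 0 0 by rewrite mxE.
  by rewrite !addE ewT [RHS]mxE [X in _ + (_ + X)]mxE -/c /= mulr1n; lra.
have c0 : c != 0.
  rewrite /c mulmx_tr_sqr psumr_neq0 => [|i _]; last exact: sqr_ge0.
  apply/hasP.
  have /rV0Pn[i wi] : w != 0 by rewrite subr_eq0.
  by exists i; rewrite ?mem_index_enum // lt_def sqr_ge0 sqrf_eq0 wi.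
pose Q := 1%:M - (2 / c) *: (w^T *m w).
have QT : Q^T = Q.
  by rewrite /Q linearB /= linearZ /= trmx_mul trmxK trmx1.
have wwE : w *m w^T = c%:M by apply: mx11_eq; rewrite [RHS]mxE mulr1n.
exists Q.
  rewrite QT {2}/Q mulmxBr mulmx1 -scalemxAr mulmxA /Q mulmxBl mul1mx.
  rewrite -scalemxAl -mulmxA wwE mul_mx_scalar.
  rewrite scalerA divfK // mulmxBl -scalemxAl scaler_nat mulr2n opprD addrA.
  by rewrite subrr add0r scalerN opprK subrK.
rewrite rowE /Q mulmxBr mulmx1 -scalemxAr mulmxA (mx11_scalar (_ *m w^T)).
rewrite ew mul_scalar_mx scalerA mulrN.
have -> : 2 / c * (c / 2) = 1 by field.
by rewrite scaleNr opprK scale1r addrC subrK.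
Qed.

(** Deflation: in an orthonormal basis starting with a unit eigenvector, the first row of the matrix
    vanishes off the diagonal, and by symmetry so does the first column. Induction handles the
    remaining block. *)
Lemma symmetric_spectral (R : realType) n (X : 'M[R]_n) : X^T = X ->
  exists U : 'M[R]_n, exists2 d : 'rV[R]_n,
    U *m U^T = 1%:M & X = U^T *m diag_mx d *m U.
Proof.
elim: n X => [|n IHn] X XT.
  by exists 1%:M, 0; rewrite [RHS]flatmx0 flatmx0.
have [a [v vX /unit_row_complete[Q Q1 Qv]]] := symmetric_eigenvector XT.
have Q2 : Q^T *m Q = 1%:M by apply: mulmx1C.
pose M : 'M[R]_(1 + n) := Q *m X *m Q^T.
have MT : M^T = M by rewrite /M !trmx_mul trmxK XT mulmxA.
have M0 : row 0 M = a *: row 0 1%:M.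
  by rewrite /M !row_mul Qv vX -scalemxAl -Qv -row_mul Q1.
have XE : X = Q^T *m M *m Q.
  by rewrite /M !mulmxA Q2 mul1mx -mulmxA Q2 mulmx1.
clearbody M.
have Mur : ursubmx M = 0.
  apply/rowP => j; move/rowP/(_ (rshift 1 j)): M0.
  by rewrite !mxE /= mulr0 => <-; congr (M _ _); apply/val_inj.
have Mdl : dlsubmx M = 0.
  by apply: trmx_inj; rewrite trmx_dlsub MT Mur trmx0.
have Mul : ulsubmx M = a%:M.
  apply: mx11_eq; move/rowP/(_ 0): M0; rewrite !mxE /= mulr1 => <-.
  by congr (M _ _); apply/val_inj.
have [U' [d' U1 ME]] : exists U : 'M[R]_n, exists2 d : 'rV[R]_n,
    U *m U^T = 1%:M & drsubmx M = U^T *m diag_mx d *m U.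
  by apply: IHn; rewrite trmx_drsub MT.
have {}ME : M = block_mx a%:M 0 0 (U'^T *m diag_mx d' *m U').
  by rewrite -(submxK M) Mur Mdl Mul ME.
pose B : 'M[R]_(1 + n) := block_mx 1%:M 0 0 U'.
have B1 : B *m B^T = 1%:M.
  rewrite /B tr_block_mx mulmx_block.
  rewrite !trmx0 trmx1 !mulmx0 !mul0mx !addr0 add0r mulmx1 U1.
  by rewrite -scalar_mx_block.
have BM : M = B^T *m diag_mx (row_mx a%:M d') *m B.
  rewrite ME /B tr_block_mx diag_mx_row !mulmx_block.
  rewrite !trmx0 trmx1 !mulmx0 !mul0mx !addr0 !add0r !mul1mx !mulmx1.
  congr block_mx; last by rewrite mul0mx.
  by apply: mx11_eq; rewrite !mxE.
exists (B *m Q), (row_mx a%:M d').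
  by rewrite trmx_mul mulmxA -(mulmxA B) Q1 mulmx1; exact: B1.
by rewrite XE BM trmx_mul !mulmxA.
Qed.

(** * Klein's inequality *)

(** The rows of [U] are the eigenvectors; orthonormality is left to the lemmas that need it. *)
Definition specmx (R : pzRingType) n (U : 'M[R]_n) (d : 'rV[R]_n) : 'M[R]_n :=
  U^T *m diag_mx d *m U.

Lemma tr_specmx (R : comPzRingType) n (U : 'M[R]_n) d :
  (specmx U d)^T = specmx U d.
Proof. by rewrite /specmx !trmx_mul trmxK tr_diag_mx mulmxA. Qed.

Section TwoBases.
Variables (R : realType) (n : nat) (U V : 'M[R]_n).
Hypotheses (U1 : U *m U^T = 1%:M) (V1 : V *m V^T = 1%:M).
Implicit Types (d e : 'rV[R]_n).

(* Squared inner products of the two bases: a doubly stochastic matrix. *)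
Definition overlap i j : R := (U *m V^T) i j ^+ 2.

Lemma overlap_ge0 i j : 0 <= overlap i j.
Proof. exact: sqr_ge0. Qed.

Lemma overlap_suml i : \sum_j overlap i j = 1.
Proof.
rewrite -mulmx_tr_sqr trmx_mul trmxK mulmxA -(mulmxA U) (mulmx1C V1) mulmx1 U1.
by rewrite mxE eqxx.
Qed.

Lemma overlap_sumr j : \sum_i overlap i j = 1.
Proof.
have -> : \sum_i overlap i j = ((U *m V^T)^T *m (U *m V^T)^T^T) j j.
  by rewrite mulmx_tr_sqr; apply: eq_bigr => i _; rewrite mxE.
rewrite trmxK trmx_mul trmxK mulmxA -(mulmxA V) (mulmx1C U1) mulmx1 V1.
by rewrite mxE eqxx.
Qed.

Lemma trace_specmxM d e :
  \tr (specmx U d *m specmx V e) = \sum_i \sum_j overlap i j * (d 0 i * e 0 j).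
Proof.
have -> : specmx U d *m specmx V e =
    U^T *m (diag_mx d *m (U *m V^T *m diag_mx e *m V)).
  by rewrite /specmx !mulmxA.
rewrite mxtrace_mulC -(mulmxA (diag_mx d)).
have -> : U *m V^T *m diag_mx e *m V *m U^T =
    (U *m V^T) *m diag_mx e *m (U *m V^T)^T.
  by rewrite trmx_mul trmxK !mulmxA.
rewrite mul_diag_mx /mxtrace; apply: eq_bigr => i _.
rewrite mxE [X in _ * X]mxE mulr_sumr; apply: eq_bigr => j _.
by rewrite mul_mx_diag [in LHS]mxE [X in _ * (_ * X)]mxE /overlap; ring.
Qed.

(** Double stochasticity turns a sum over one spectrum into a weighted double sum, to be merged term
    by term with [trace_specmxM]. *)
Lemma sum_overlapl (f : 'I_n -> R) :
  \sum_i \sum_j overlap i j * f i = \sum_i f i.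
Proof. by apply: eq_bigr => i _; rewrite -mulr_suml overlap_suml mul1r. Qed.

Lemma sum_overlapr (f : 'I_n -> R) :
  \sum_i \sum_j overlap i j * f j = \sum_i f i.
Proof.
rewrite exchange_big /=.
by apply: eq_bigr => i _; rewrite -mulr_suml overlap_sumr mul1r.
Qed.

End TwoBases.

Section Spectral.
Variables (R : realType) (n : nat).
Implicit Types (U V : 'M[R]_n) (d e : 'rV[R]_n).

Lemma trace_specmx U d : U *m U^T = 1%:M -> \tr (specmx U d) = \sum_i d 0 i.
Proof.
move=> U1; rewrite /specmx -mulmxA mxtrace_mulC -mulmxA U1 mulmx1.
exact: mxtrace_diag.
Qed.

Lemma specmxM U d e : U *m U^T = 1%:M ->
  specmx U d *m specmx U e = specmx U (\row_i (d 0 i * e 0 i)).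
Proof.
by move=> U1; rewrite /specmx -mulmx_diag !mulmxA -(mulmxA _ U) U1 mulmx1.
Qed.

Lemma trace_specmx_sqr U d : U *m U^T = 1%:M ->
  \tr (specmx U d *m specmx U d) = \sum_i d 0 i ^+ 2.
Proof.
move=> U1; rewrite specmxM // trace_specmx //.
by apply: eq_bigr => i _; rewrite mxE expr2.
Qed.

(** The squared Frobenius distance when [X - Y] is symmetric. The trace form lets it be expanded in
    two eigenbases at once. *)
Definition dist2 (X Y : 'M[R]_n) := \tr ((X - Y) *m (X - Y)).

Lemma dist2_specmx U V d e : U *m U^T = 1%:M -> V *m V^T = 1%:M ->
  dist2 (specmx U d) (specmx V e) =
  \sum_i \sum_j overlap U V i j * (d 0 i - e 0 j) ^+ 2.
Proof.
move=> U1 V1; rewrite /dist2 mulmxBl !mulmxBr !linearB /=.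
rewrite (mxtrace_mulC (specmx V e)).
rewrite !trace_specmx_sqr // trace_specmxM.
rewrite -(sum_overlapl U1 V1 (fun i => d 0 i ^+ 2)).
rewrite -(sum_overlapr U1 V1 (fun i => e 0 i ^+ 2)).
rewrite opprK -!sumrN -!big_split; apply: eq_bigr => i _.
rewrite -!sumrN -!big_split; apply: eq_bigr => j _ /=.
by ring.
Qed.

(** By symmetry the trace is that of [X *m X^T], the sum of all squared entries. *)
Lemma symmetric_entry_sqr (X : 'M[R]_n) i j : X^T = X ->
  X i j ^+ 2 <= \tr (X *m X).
Proof.
move=> XT; rewrite -[X in _ *m X]XT /mxtrace.
rewrite (bigD1 i) //= mulmx_tr_sqr (bigD1 j) //= -addrA lerDl addr_ge0 //.
  by apply: sumr_ge0 => k _; exact: sqr_ge0.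
apply: sumr_ge0 => k _; rewrite mulmx_tr_sqr sumr_ge0 // => l _.
exact: sqr_ge0.
Qed.

Lemma symmetric_trace_sqr_eq0 (X : 'M[R]_n) :
  X^T = X -> \tr (X *m X) <= 0 -> X = 0.
Proof.
move=> XT X0; apply/matrixP => i j; rewrite mxE; apply/eqP.
by rewrite -sqrf_eq0 eq_le sqr_ge0 (le_trans (symmetric_entry_sqr i j XT)).
Qed.

Lemma quadratic_specmx U d (v : 'cV[R]_n) :
  (v^T *m specmx U d *m v) 0 0 = \sum_i d 0 i * (U *m v) i 0 ^+ 2.
Proof.
have -> : v^T *m specmx U d *m v = (U *m v)^T *m (diag_mx d *m (U *m v)).
  by rewrite /specmx trmx_mul !mulmxA.
rewrite mxE; apply: eq_bigr => i _.
by rewrite [X in X * _]mxE mul_diag_mx [X in _ * X]mxE; ring.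
Qed.

Lemma quadratic_specmx_row U d i : U *m U^T = 1%:M ->
  ((row i U)^T^T *m specmx U d *m (row i U)^T) 0 0 = d 0 i.
Proof.
move=> U1; rewrite quadratic_specmx tr_row colE mulmxA U1 mul1mx.
rewrite (bigD1 i) //= mxE !eqxx expr1n mulr1 big1 ?addr0 // => j ji.
by rewrite mxE (negbTE ji) expr0n mulr0.
Qed.

(** Conjugation by an orthogonal matrix of constant polynomials preserves the determinant, which
    reduces the claim to a diagonal matrix. *)
Lemma char_poly_specmx U d : U *m U^T = 1%:M ->
  char_poly (specmx U d) =
  \prod_(x <- [seq d 0 i | i <- enum 'I_n]) ('X - x%:P).
Proof.
move=> U1; rewrite big_map big_enum /= /char_poly.
have -> : char_poly_mx (specmx U d) =
    map_mx polyC U^T *m char_poly_mx (diag_mx d) *m map_mx polyC U.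
  rewrite /char_poly_mx mulmxBr mulmxBl mul_mx_scalar -scalemxAl -map_mxM.
  by rewrite (mulmx1C U1) map_mx1 scalemx1 /specmx !map_mxM.
rewrite !det_mulmx mulrAC -det_mulmx -map_mxM (mulmx1C U1) map_mx1 det1 mul1r.
rewrite -/(char_poly _) char_poly_trig ?diag_mx_is_trig //.
by apply: eq_bigr => i _; rewrite mxE eqxx mulr1n.
Qed.

(* Fenchel-Young for [s ln s], which is the conjugate of [exp (x - 1)]. *)
Lemma xlnx_young (s x : R) : 0 <= s -> 0 <= s * ln s - s * x + expR (x - 1).
Proof.
rewrite le_eqVlt => /predU1P[<-|s0].
  by rewrite !mul0r subrr add0r expR_ge0.
(* This is [1 + y <= expR y] at [y = x - 1 - ln s], scaled by [s]. *)
have : s * (1 + (x - 1 - ln s)) <= s * expR (x - 1 - ln s).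
  by rewrite ler_pM2l // expR_ge1Dx.
rewrite expRD expRN lnK ?posrE // mulrCA mulfV ?gt_eqF // mulr1.
by lra.
Qed.

(** For [s > 0], [1 + y < expR y] is strict unless [y = x - 1 - ln s] is zero; at [s = 0] the left
    side is a positive exponential. *)
Lemma xlnx_young_eq (s x : R) : 0 <= s ->
  s * ln s - s * x + expR (x - 1) = 0 -> s = expR (x - 1).
Proof.
rewrite le_eqVlt => /predU1P[<-|s0].
  by rewrite !mul0r subrr add0r => /eqP; rewrite gt_eqF // expR_gt0.
have [x1 _|x1] := eqVneq (x - 1 - ln s) 0.
  by have -> : x - 1 = ln s by [lra]; rewrite lnK.
have : s * (1 + (x - 1 - ln s)) < s * expR (x - 1 - ln s).
  by rewrite ltr_pM2l // expR_gt1Dx.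
rewrite expRD expRN lnK ?posrE // mulrCA mulfV ?gt_eqF // mulr1.
by lra.
Qed.

Lemma xlnx_young_expR (x : R) :
  expR (x - 1) * ln (expR (x - 1)) - expR (x - 1) * x = - expR (x - 1).
Proof. by rewrite expRK; ring. Qed.

(** The tangent to [expR] at the larger point lies below the graph. The squared form matches the
    summands of [dist2_specmx]. *)
Lemma expR_lipschitz (M x y : R) : x <= M -> y <= M ->
  (expR x - expR y) ^+ 2 <= expR M ^+ 2 * (x - y) ^+ 2.
Proof.
have sqB (u v : R) : (u - v) ^+ 2 = (v - u) ^+ 2 by ring.
wlog xy : x y / x <= y => [H xM yM|xM yM].
  have [|/ltW yx] := leP x y; first by move=> /H; apply.
  by rewrite sqB (sqB x); apply: H.
have e0 : 0 <= expR y - expR x by rewrite subr_ge0 ler_expR.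
have H : expR y - expR x <= expR M * (y - x).
  have H : expR y * (1 + (x - y)) <= expR y * expR (x - y).
    by rewrite ler_pM2l ?expR_gt0 // expR_ge1Dx.
  rewrite -expRD [y + _]addrC subrK in H.
  have : expR y * (y - x) <= expR M * (y - x).
    by rewrite ler_wpM2r ?subr_ge0 // ler_expR.
  by lra.
by rewrite sqB (sqB x) -exprMn ler_pXn2r // nnegrE ?(le_trans e0 H).
Qed.

(** The spectrum of [exp (X - I)] when [d] is the spectrum of [X]. *)
Definition exp_diag d : 'rV[R]_n := \row_i expR (d 0 i - 1).

Lemma trace_exp_diag U d : U *m U^T = 1%:M ->
  \tr (specmx U (exp_diag d)) = \sum_i expR (d 0 i - 1).
Proof.
by move=> U1; rewrite trace_specmx //; apply: eq_bigr => i _; rewrite mxE.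
Qed.

Lemma klein_sumE U V d e : U *m U^T = 1%:M -> V *m V^T = 1%:M ->
  \sum_i d 0 i * ln (d 0 i) - \tr (specmx U d *m specmx V e) +
    \tr (specmx V (exp_diag e)) =
  \sum_i \sum_j overlap U V i j *
    (d 0 i * ln (d 0 i) - d 0 i * e 0 j + expR (e 0 j - 1)).
Proof.
move=> U1 V1; rewrite trace_exp_diag // trace_specmxM.
rewrite -(sum_overlapl U1 V1 (fun i => d 0 i * ln (d 0 i))).
rewrite -(sum_overlapr U1 V1 (fun i => expR (e 0 i - 1))).
rewrite -!sumrN -!big_split; apply: eq_bigr => i _.
rewrite -!sumrN -!big_split; apply: eq_bigr => j _ /=.
by ring.
Qed.

Lemma klein_ge0 U V d e : U *m U^T = 1%:M -> V *m V^T = 1%:M ->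
    (forall i, 0 <= d 0 i) ->
  0 <= \sum_i d 0 i * ln (d 0 i) - \tr (specmx U d *m specmx V e) +
    \tr (specmx V (exp_diag e)).
Proof.
move=> U1 V1 d0; rewrite klein_sumE //.
by do 2![apply: sumr_ge0 => ? _]; rewrite mulr_ge0 ?overlap_ge0 ?xlnx_young.
Qed.

(** A vanishing sum of nonnegative terms vanishes termwise: for each pair either the overlap is zero
    or [d 0 i = expR (e 0 j - 1)]. Either way the corresponding term of [dist2] is zero. *)
Lemma klein_eq0 U V d e : U *m U^T = 1%:M -> V *m V^T = 1%:M ->
    (forall i, 0 <= d 0 i) ->
  \sum_i d 0 i * ln (d 0 i) - \tr (specmx U d *m specmx V e) +
    \tr (specmx V (exp_diag e)) = 0 ->
  specmx U d = specmx V (exp_diag e).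
Proof.
move=> U1 V1 d0; rewrite klein_sumE // => /eqP.
have t0 i j : 0 <= overlap U V i j *
    (d 0 i * ln (d 0 i) - d 0 i * e 0 j + expR (e 0 j - 1)).
  by rewrite mulr_ge0 ?overlap_ge0 ?xlnx_young.
rewrite psumr_eq0 => [/allP k0|i _]; last by apply: sumr_ge0 => j _; exact: t0.
apply/eqP; rewrite -subr_eq0; apply/eqP/symmetric_trace_sqr_eq0.
  by rewrite linearB /= !tr_specmx.
rewrite -/(dist2 _ _) dist2_specmx // big1 // => i _; rewrite big1 // => j _.
have := k0 i (mem_index_enum i).
rewrite /= psumr_eq0 => [/allP kj|? _]; last exact: t0.
have := kj j (mem_index_enum j); rewrite /= mulf_eq0 => /orP[/eqP->|/eqP].
  by rewrite mul0r.
by move=> /xlnx_young_eq -> //; rewrite mxE subrr expr0n mulr0.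
Qed.

Lemma exp_diag_lipschitz U V d e (M : R) : U *m U^T = 1%:M -> V *m V^T = 1%:M ->
    (forall i, d 0 i <= M) -> (forall i, e 0 i <= M) ->
  dist2 (specmx U (exp_diag d)) (specmx V (exp_diag e)) <=
  expR M ^+ 2 * dist2 (specmx U d) (specmx V e).
Proof.
move=> U1 V1 dM eM; rewrite !dist2_specmx // mulr_sumr.
apply: ler_sum => i _; rewrite mulr_sumr; apply: ler_sum => j _.
rewrite [leRHS]mulrCA ler_wpM2l ?overlap_ge0 // !mxE.
apply: le_trans (@expR_lipschitz M _ _ _ _) _.
- by rewrite lerBlDr (le_trans (dM i)) // lerDl.
- by rewrite lerBlDr (le_trans (eM j)) // lerDl.
by rewrite opprB addrA subrK.
Qed.

End Spectral.

(** * Symmetric matrices and their exponential *)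

Section SymmetricMatrices.
Variables (R : realType) (n : nat).
Implicit Types (X Y : symmx R n) (U : 'M[R]_n) (d : 'rV[R]_n).

Lemma symmetricmxE (X : 'M[R]_n) : (X \is symmetricmx) = (X^T == X).
Proof. by rewrite is_hermitianmxE expr0 scale1r map_mx_id // eq_sym. Qed.

Lemma tr_symmx X : (X : 'M[R]_n)^T = X.
Proof. by apply/eqP; rewrite -symmetricmxE; case: X. Qed.

Lemma specmx_symmetric U d : specmx U d \is symmetricmx.
Proof. by rewrite symmetricmxE tr_specmx. Qed.

Definition spec_symmx U d : symmx R n := SymMx (specmx_symmetric U d).

Lemma symmx_spectral X : exists p : 'M[R]_n * 'rV[R]_n,
  p.1 *m p.1^T = 1%:M /\ (X : 'M[R]_n) = specmx p.1 p.2.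
Proof.
by have [U [d U1 XE]] := symmetric_spectral (tr_symmx X); exists (U, d).
Qed.

(** Chosen separately for each [X], so neither the basis nor the spectrum need vary continuously;
    continuity of the exponential comes from a Lipschitz estimate instead. *)
Definition eigenbasis X : 'M[R]_n := (sval (cid (symmx_spectral X))).1.
Definition eigenrow X : 'rV[R]_n := (sval (cid (symmx_spectral X))).2.

Lemma eigenbasis_orth X : eigenbasis X *m (eigenbasis X)^T = 1%:M.
Proof. exact: (svalP (cid (symmx_spectral X))).1. Qed.

Lemma eigenbasisE X : (X : 'M[R]_n) = specmx (eigenbasis X) (eigenrow X).
Proof. exact: (svalP (cid (symmx_spectral X))).2. Qed.

(** The list [eigenvalues X] and the entries of [d] give two factorizations of the characteristic
    polynomial, hence agree up to permutation, and the sum ignores order. *)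
Lemma tr_xlnx_specmx X U d : U *m U^T = 1%:M -> (X : 'M[R]_n) = specmx U d ->
  tr_xlnx X = \sum_i d 0 i * ln (d 0 i).
Proof.
move=> U1 XE; have cX := char_poly_specmx d U1.
have ex : exists s, [set s | char_poly X = \prod_(x <- s) ('X - x%:P)] s.
  by exists [seq d 0 i | i <- enum 'I_n]; rewrite /= XE.
have : char_poly X = \prod_(x <- eigenvalues X) ('X - x%:P) := xgetPex [::] ex.
rewrite XE cX => /prod_XsubC_eq dX.
by rewrite /tr_xlnx -(perm_big _ dX) big_map big_enum.
Qed.

Lemma psd_eigenrow X i : psd X -> 0 <= eigenrow X 0 i.
Proof.
move=> X0; rewrite -(quadratic_specmx_row _ i (eigenbasis_orth X)) -eigenbasisE.
exact: X0.
Qed.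

Lemma pd_eigenrow X i : pd X -> 0 < eigenrow X 0 i.
Proof.
move=> X0; rewrite -(quadratic_specmx_row _ i (eigenbasis_orth X)) -eigenbasisE.
apply: X0; apply/eqP => r0.
(* With constant spectrum 1 the form is the squared norm of the row, which is 1. *)
have := quadratic_specmx_row (const_mx 1) i (eigenbasis_orth X).
by rewrite r0 mulmx0 !mxE => /eqP; rewrite eq_sym oner_eq0.
Qed.

Lemma pd_psd X : pd X -> psd X.
Proof.
move=> X0 v; have [->|/X0/ltW//] := eqVneq v 0.
by rewrite mulmx0 mxE.
Qed.

Lemma pd_spec_symmx U d : U *m U^T = 1%:M -> (forall i, 0 < d 0 i) ->
  pd (spec_symmx U d).
Proof.
move=> U1 d0 v v0; rewrite /= quadratic_specmx lt_def.
have t0 i : 0 <= d 0 i * (U *m v) i 0 ^+ 2 by rewrite mulr_ge0 ?sqr_ge0 ?ltW.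
rewrite sumr_ge0 ?andbT //; apply: contra v0; rewrite psumr_eq0 // => /allP k0.
suff Uv : U *m v = 0 by rewrite -(mul1mx v) -(mulmx1C U1) -mulmxA Uv mulmx0.
apply/colP => i; rewrite [RHS]mxE; have := k0 i (mem_index_enum i).
by rewrite /= mulf_eq0 gt_eqF //= sqrf_eq0 => /eqP.
Qed.

(* [exp (X - I)] *)
Definition exp_symmx X : symmx R n :=
  spec_symmx (eigenbasis X) (exp_diag (eigenrow X)).

Lemma pd_exp_symmx X : pd (exp_symmx X).
Proof.
by apply: pd_spec_symmx (eigenbasis_orth X) _ => i; rewrite mxE expR_gt0.
Qed.

Lemma klein X Y : psd X ->
  symdot X Y - \tr (exp_symmx Y : 'M[R]_n) <= tr_xlnx X.
Proof.
move=> X0; rewrite (tr_xlnx_specmx (eigenbasis_orth X) (eigenbasisE X)).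
have := klein_ge0 (eigenrow Y) (eigenbasis_orth X) (eigenbasis_orth Y)
  (fun i => psd_eigenrow i X0).
rewrite -!eigenbasisE /symdot /exp_symmx /=. lra.
Qed.

Lemma klein_eq X Y : psd X ->
  tr_xlnx X = symdot X Y - \tr (exp_symmx Y : 'M[R]_n) -> X = exp_symmx Y.
Proof.
move=> X0; rewrite (tr_xlnx_specmx (eigenbasis_orth X) (eigenbasisE X)) => XY.
apply/val_inj; rewrite /= [LHS]eigenbasisE.
apply: (klein_eq0 (eigenbasis_orth X) (eigenbasis_orth Y)
  (fun i => psd_eigenrow i X0)).
by rewrite XY -!eigenbasisE /symdot /exp_symmx /=; ring.
Qed.

(** The two matrices share an eigenbasis, so equality in Klein's inequality reduces to the scalar
    equality [xlnx_young_expR]. *)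
Lemma tr_xlnx_exp Y :
  tr_xlnx (exp_symmx Y) = symdot (exp_symmx Y) Y - \tr (exp_symmx Y : 'M[R]_n).
Proof.
rewrite (@tr_xlnx_specmx _ (eigenbasis Y) (exp_diag (eigenrow Y)))
  ?eigenbasis_orth //.
rewrite /symdot [X in _ *m X]eigenbasisE /= specmxM ?eigenbasis_orth //.
rewrite !trace_specmx ?eigenbasis_orth // -sumrB.
by apply: eq_bigr => i _; rewrite !mxE -xlnx_young_expR; ring.
Qed.

Lemma eigenrow_le X (M : R) i : 0 <= M -> \tr (X *m X) <= M ^+ 2 ->
  eigenrow X 0 i <= M.
Proof.
move=> M0; rewrite eigenbasisE trace_specmx_sqr ?eigenbasis_orth // => XM.
apply: le_trans (ler_norm _) _.
rewrite -ler_sqr ?nnegrE // real_normK ?num_real //.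
apply: le_trans XM; rewrite (bigD1 i) //= lerDl.
by apply: sumr_ge0 => j _; exact: sqr_ge0.
Qed.

Lemma exp_symmx_lipschitz X Y (M : R) : 0 <= M ->
    \tr (X *m X) <= M ^+ 2 -> \tr (Y *m Y) <= M ^+ 2 ->
  dist2 (exp_symmx X) (exp_symmx Y) <= expR M ^+ 2 * dist2 X Y.
Proof.
move=> M0 XM YM.
rewrite [X in _ * dist2 X _]eigenbasisE [X in _ * dist2 _ X]eigenbasisE.
by apply: exp_diag_lipschitz; rewrite ?eigenbasis_orth // => i;
  exact: eigenrow_le.
Qed.

End SymmetricMatrices.

(** * Trace pairing and coercivity *)

Section SymmetricAlgebra.
Variables (R : realType) (n : nat).
Implicit Types (X Y Z : symmx R n).

Lemma symmx_valB X Y : (X - Y : symmx R n) = (X : 'M[R]_n) - Y :> 'M[R]_n.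
Proof. exact: (raddfB (\val : symmx R n -> _)). Qed.

Lemma symmx_valZ (a : R) X :
  (a *: X : symmx R n) = a *: (X : 'M[R]_n) :> 'M[R]_n.
Proof. by change (\val (a *: X) = a *: \val X); rewrite linearZ. Qed.

Lemma symmx_val_sum (I : Type) (r : seq I) (F : I -> symmx R n) :
  (\sum_(i <- r) F i : symmx R n) = \sum_(i <- r) (F i : 'M[R]_n) :> 'M[R]_n.
Proof. exact: (raddf_sum (\val : symmx R n -> _)). Qed.

Lemma symdotC X Y : symdot X Y = symdot Y X.
Proof. exact: mxtrace_mulC. Qed.

Lemma symdotBr X Y Z : symdot X (Y - Z) = symdot X Y - symdot X Z.
Proof. by rewrite /symdot symmx_valB mulmxBr linearB. Qed.

Lemma symdotZr (a : R) X Y : symdot X (a *: Y) = a * symdot X Y.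
Proof. by rewrite /symdot symmx_valZ -scalemxAr linearZ. Qed.

(** A squared entry is at most the sum of squared eigenvalues, itself at most the square of the sum
    of their absolute values. *)
Lemma symmx_entry_le X i j : `|X i j| <= \sum_k `|eigenrow X 0 k|.
Proof.
rewrite -ler_sqr ?nnegrE ?sumr_ge0 // real_normK ?num_real //.
apply: le_trans (symmetric_entry_sqr i j (tr_symmx X)) _.
rewrite {1 2}(eigenbasisE X) trace_specmx_sqr ?eigenbasis_orth //.
rewrite expr2 mulr_suml.
apply: ler_sum => k _; rewrite -(real_normK (num_real _)) expr2.
by rewrite ler_wpM2l // (bigD1 k) //= lerDl sumr_ge0.
Qed.

(* Young's inequality at [s = d + delta] and [s = d - delta] makes the linear
   term absorb [delta * `|x|]. *)
Lemma young_coercive (delta T d x : R) : 0 < delta -> delta <= d -> d <= T ->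
  d * x - expR (x - 1) <= (T + delta) ^+ 2 - delta * `|x|.
Proof.
move=> delta0 dd dT.
have H s : 0 <= s -> s <= T + delta -> s * x - expR (x - 1) <= (T + delta) ^+ 2.
  move=> s0 sT; have := xlnx_young x s0.
  have : s * ln s <= (T + delta) ^+ 2.
    apply: (@le_trans _ _ (s * s)); last by rewrite expr2 ler_pM.
    move: s0; rewrite le_eqVlt => /predU1P[<-|s0]; first by rewrite !mul0r.
    by rewrite ler_pM2l // ltW // ln_sublinear.
  by lra.
have [x0|x0] := leP 0 x.
  rewrite ger0_norm //; have := H (d + delta); lra.
by rewrite ltr0_norm //; have := H (d - delta); lra.
Qed.

(** All eigenvalues of [X] lie between some [delta > 0] and their sum [T], so [young_coercive]
    applies to every pair of eigenvalues of [X] and [Y]. Averaging with the overlaps leaves the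
    absolute eigenvalues of [Y], which dominate its entries. *)
Lemma exp_coercive X : pd X -> exists2 delta, 0 < delta &
  exists K, forall Y i j,
    symdot X Y - \tr (exp_symmx Y : 'M[R]_n) <= K - delta * `|Y i j|.
Proof.
move=> X0; pose d := eigenrow X.
have d0 i : 0 < d 0 i by exact: pd_eigenrow.
(* Its inverse exceeds every [(d 0 i)^-1]; the summand 1 keeps it positive when [n = 0]. *)
pose delta := (1 + \sum_i (d 0 i)^-1)^-1.
have delta0 : 0 < delta.
  by rewrite invr_gt0 ltr_pwDl // sumr_ge0 // => i _; rewrite invr_ge0 ltW.
have deltad i : delta <= d 0 i.
  rewrite -[leRHS]invrK lef_pV2 ?posrE ?invr_gt0 //; last first.
    by rewrite -invr_gt0.
  rewrite (bigD1 i) //= addrCA lerDl addr_ge0 // sumr_ge0 // => j _.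
  by rewrite invr_ge0 ltW.
pose T := \sum_i d 0 i.
have dT i : d 0 i <= T.
  by rewrite /T (bigD1 i) //= lerDl sumr_ge0 // => j _; rewrite ltW.
exists delta => //; exists (\sum_(i < n) (T + delta) ^+ 2) => Y i j.
apply: (@le_trans _ _ (\sum_(k < n) (T + delta) ^+ 2 -
    delta * \sum_k `|eigenrow Y 0 k|)); last first.
  by rewrite lerD2l lerN2 ler_pM2l // symmx_entry_le.
have UX := eigenbasis_orth X; have UY := eigenbasis_orth Y.
rewrite /symdot (eigenbasisE X) [X in _ *m X]eigenbasisE trace_specmxM //.
rewrite trace_exp_diag // mulr_sumr -[leRHS]sumrB.
rewrite -(sum_overlapr UX UY (fun k => expR (eigenrow Y 0 k - 1))).
rewrite -[leRHS](sum_overlapr UX UY (fun k => (T + delta) ^+ 2 -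
  delta * `|eigenrow Y 0 k|)) -sumrB; apply: ler_sum => k _.
rewrite -sumrB; apply: ler_sum => l _.
by rewrite -mulrBr ler_wpM2l ?overlap_ge0 // young_coercive.
Qed.

End SymmetricAlgebra.

(** * Continuity of the matrix exponential *)

Section ExpContinuity.
Variables (R : realType) (n : nat) (T : topologicalType) (phi : T -> symmx R n).
Hypothesis phi_cont : forall i j, continuous (fun t => phi t i j).

Lemma continuous_sumr (I : Type) (r : seq I) (f : I -> T -> R) :
  (forall i, continuous (f i)) -> continuous (fun t => \sum_(i <- r) f i t).
Proof.
move=> fc t; elim: r => [|i r IHr].
  by under eq_fun do rewrite big_nil; exact: cvg_cst.
under eq_fun do rewrite big_cons.
by apply: cvgD; [exact: fc | exact: IHr].
Qed.

Lemma continuous_trace_mul (psi chi : T -> 'M[R]_n) :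
  (forall i j, continuous (fun t => psi t i j)) ->
  (forall i j, continuous (fun t => chi t i j)) ->
  continuous (fun t => \tr (psi t *m chi t)).
Proof.
move=> pc cc; rewrite /mxtrace.
have -> : (fun t => \sum_i (psi t *m chi t) i i) =
    (fun t => \sum_i \sum_j psi t i j * chi t j i).
  by apply/funext => t; apply: eq_bigr => i _; rewrite mxE.
apply: continuous_sumr => i; apply: continuous_sumr => j t.
by apply: cvgM; [exact: pc | exact: cc].
Qed.

Lemma continuous_exp_symmx i j : continuous (fun t => exp_symmx (phi t) i j).
Proof.
(* Near [t] one has [r s < M], and [M <= M ^+ 2] because [M >= 1]; this is the bound that
   [exp_symmx_lipschitz] asks for. *)
move=> t; pose r s := \tr (phi s *m phi s); pose M := r t + 1.
have rc : continuous r by exact: continuous_trace_mul.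
have qc : continuous (fun s => dist2 (phi s) (phi t)).
  by apply: continuous_trace_mul => k l s; under eq_fun do rewrite !mxE;
    apply: cvgB; [exact: phi_cont | exact: cvg_cst
                 | exact: phi_cont | exact: cvg_cst].
have r0 : 0 <= r t.
  rewrite /r (eigenbasisE (phi t)) trace_specmx_sqr ?eigenbasis_orth //.
  by apply: sumr_ge0 => k _; exact: sqr_ge0.
have M0 : 0 <= M by rewrite addr_ge0.
have M2 : r t + 1 <= M ^+ 2 by rewrite expr2 ler_peMr // /M lerDr.
apply/cvgrPdist_lt => e e0.
have rM : \forall s \near t, r s < r t + 1.
  by apply: (cvgr_lt (r t)); [exact: rc | rewrite ltrDl].
(* The radius cancels the Lipschitz factor [expR M ^+ 2]. *)
have qe : \forall s \near t, dist2 (phi s) (phi t) < (e / expR M) ^+ 2.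
  apply: (cvgr_lt (dist2 (phi t) (phi t))); first exact: qc.
  by rewrite /dist2 subrr mul0mx mxtrace0 exprn_gt0 // divr_gt0 ?expR_gt0.
near=> s.
have rs : r s < r t + 1 by near: s.
have qs : dist2 (phi s) (phi t) < (e / expR M) ^+ 2 by near: s.
have rt : r t <= r t + 1 by rewrite lerDl.
have L := exp_symmx_lipschitz M0 (le_trans (ltW rs) M2) (le_trans rt M2).
rewrite distrC -ltr_sqr ?nnegrE ?(ltW e0) // real_normK ?num_real //.
have := symmetric_entry_sqr i j
  (tr_symmx (exp_symmx (phi s) - exp_symmx (phi t))).
rewrite !symmx_valB -/(dist2 _ _) mxE [X in _ + X]mxE => /le_lt_trans; apply.
apply: le_lt_trans L _; move: qs.
rewrite expr_div_n ltr_pdivlMr ?exprn_gt0 ?expR_gt0 //.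
by rewrite mulrC.
Unshelve. all: end_near.
Qed.

End ExpContinuity.

Lemma ereal_inf_attained (R : realType) (T : Type) (S : set T) (f : T -> R) x :
  S x -> (forall y, S y -> f x <= f y) ->
  ereal_inf [set (f y)%:E | y in S] = (f x)%:E.
Proof.
move=> Sx fx; apply/eqP; rewrite eq_le; apply/andP; split.
  by apply: ereal_inf_lbound; exists x.
by apply: le_ereal_inf_tmp => _ [y Sy <-]; rewrite lee_fin fx.
Qed.

(** * The dual problem *)

Section Duality.
Variables (R : realType) (n m : nat) (C : symmx R n) (b : 'cV[R]_m) (eps : R).
Variables (A : {linear symmx R n -> 'cV[R]_m})
  (As : {linear 'cV[R]_m -> symmx R n}).
Hypotheses (eps0 : 0 < eps) (adjA : is_adjoint A As).
Implicit Types (X : symmx R n) (l d : 'cV[R]_m).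

Lemma vecdotBl (u v w : 'cV[R]_m) : vecdot (u - v) w = vecdot u w - vecdot v w.
Proof. by rewrite /vecdot linearB /= mulmxBl mxE [X in _ + X]mxE. Qed.

Lemma vecdotBr (u v w : 'cV[R]_m) : vecdot u (v - w) = vecdot u v - vecdot u w.
Proof. by rewrite /vecdot mulmxBr mxE [X in _ + X]mxE. Qed.

Lemma vecdotZr (a : R) (u v : 'cV[R]_m) : vecdot u (a *: v) = a * vecdot u v.
Proof. by rewrite /vecdot -scalemxAr mxE. Qed.

Lemma vecdot_self_eq0 (u : 'cV[R]_m) : vecdot u u <= 0 -> u = 0.
Proof.
rewrite /vecdot -{2}(trmxK u) mulmx_tr_sqr => u0; apply/colP => i; rewrite mxE.
have ui : \sum_j u^T 0 j ^+ 2 = 0.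
  by apply/eqP; rewrite eq_le u0 sumr_ge0 // => j _; exact: sqr_ge0.
move/eqP: ui; rewrite psumr_eq0 => [/allP/(_ i (mem_index_enum i))|j _].
  by rewrite /= sqrf_eq0 mxE => /eqP.
exact: sqr_ge0.
Qed.

(** The shift by [- I] is already part of [exp_symmx]. *)
Definition exponent l : symmx R n := eps^-1 *: (As l - C).

Definition primal_point l : symmx R n := exp_symmx (exponent l).

Definition lagrangian X l :=
  vecdot b l + (symdot X (C - As l) + eps * tr_xlnx X).

Definition dual_value l := vecdot b l - eps * \tr (primal_point l : 'M[R]_n).

Lemma symdot_exponent X l : eps * symdot X (exponent l) = - symdot X (C - As l).
Proof.
by rewrite /exponent symdotZr mulrA mulfV ?gt_eqF // mul1r !symdotBr opprB.
Qed.

(** Klein's inequality at [Y = exponent l], multiplied by [eps]. *)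
Lemma dual_value_le X l : psd X -> dual_value l <= lagrangian X l.
Proof.
move=> X0; rewrite /dual_value /lagrangian.
have := klein (exponent l) X0; rewrite -(ler_pM2l eps0) mulrBr symdot_exponent.
by rewrite /primal_point; lra.
Qed.

Lemma dual_value_eq X l :
  psd X -> dual_value l = lagrangian X l -> X = primal_point l.
Proof.
move=> X0; rewrite /dual_value /lagrangian => H.
apply: klein_eq => //; apply: (mulfI (lt0r_neq0 eps0)).
by rewrite mulrBr symdot_exponent; move: H; rewrite /primal_point; lra.
Qed.

Lemma dual_value_lagrangian l : dual_value l = lagrangian (primal_point l) l.
Proof.
rewrite /dual_value /lagrangian /primal_point tr_xlnx_exp mulrBr.
by rewrite symdot_exponent; ring.
Qed.

Lemma dual_functionE l : dual_function C As b eps l = (dual_value l)%:E.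
Proof.
rewrite /dual_function (@ereal_inf_attained _ _ _
  (fun X => symdot X (C - As l) + eps * tr_xlnx X) (primal_point l)).
- by rewrite -EFinD dual_value_lagrangian.
- exact/pd_psd/pd_exp_symmx.
move=> X X0; have := dual_value_le l X0.
by rewrite dual_value_lagrangian /lagrangian lerD2l.
Qed.

(** The multiplier terms cancel, as [<X, As l> = <A X, l> = <b, l>]. With [dual_value_le] this is
    weak duality. *)
Lemma lagrangian_feasible X l :
  feasible A b X -> lagrangian X l = objective C eps X.
Proof.
move=> [AX _]; rewrite /lagrangian /objective symdotBr -adjA AX symdotC; ring.
Qed.

(** The Lagrangian is affine in the multiplier: evaluated at [primal_point l'], it bounds the dual
    value from above at [l] and equals it at [l']. *)
Lemma dual_value_supergradient l l' :
  dual_value l <= dual_value l' + vecdot (b - A (primal_point l')) (l - l').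
Proof.
have P0 : psd (primal_point l') by exact/pd_psd/pd_exp_symmx.
have := dual_value_le l P0; rewrite [dual_value l']dual_value_lagrangian.
rewrite /lagrangian vecdotBl (adjA _ (l - l')) linearB /= !symdotBr vecdotBr.
by lra.
Qed.

Lemma continuous_vecdot (T : topologicalType) (u : 'cV[R]_m)
    (f : T -> 'cV[R]_m) :
  (forall k, continuous (fun t => f t k 0)) ->
  continuous (fun t => vecdot u (f t)).
Proof.
move=> fc.
have -> : (fun t => vecdot u (f t)) = (fun t => \sum_k u k 0 * f t k 0).
  by apply/funext => t; rewrite /vecdot mxE; apply: eq_bigr => k _; rewrite mxE.
by apply: continuous_sumr => k t; apply: cvgM; [exact: cvg_cst | exact: fc].
Qed.

Lemma continuous_exponent (T : topologicalType) (f : T -> 'cV[R]_m) :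
  (forall k, continuous (fun t => f t k 0)) ->
  forall i j, continuous (fun t => exponent (f t) i j).
Proof.
move=> fc i j.
have -> : (fun t => exponent (f t) i j) = (fun t =>
    eps^-1 * (\sum_k f t k 0 * As (delta_mx k 0) i j - C i j)).
  apply/funext => t; rewrite /exponent symmx_valZ symmx_valB 3!mxE.
  congr (_ * (_ + _)).
  rewrite {1}(matrix_sum_delta (f t)) exchange_big big_ord1 linear_sum /=.
  rewrite symmx_val_sum summxE; apply: eq_bigr => k _.
  by rewrite linearZ symmx_valZ mxE.
move=> t; apply: cvgM; first exact: cvg_cst.
apply: cvgB; last exact: cvg_cst.
by apply: continuous_sumr => k u; apply: cvgM; [exact: fc | exact: cvg_cst].
Qed.

Lemma continuous_dual_value (T : topologicalType) (f : T -> 'cV[R]_m) :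
  (forall k, continuous (fun t => f t k 0)) ->
  continuous (fun t => dual_value (f t)).
Proof.
move=> fc t; apply: cvgB; first exact: (continuous_vecdot fc).
apply: cvgM; first exact: cvg_cst.
by apply: continuous_sumr => i; exact/continuous_exp_symmx/continuous_exponent.
Qed.

(** Supergradients replace differentiation. Along the residual [d], maximality at [l] forces
    [h t = <b - A (P t), d>] to be nonpositive for [t > 0]; by continuity [h 0 = <d, d>] is
    nonpositive too. *)
Lemma dual_value_maximizer_feasible l :
  (forall l', dual_value l' <= dual_value l) -> A (primal_point l) = b.
Proof.
move=> lmax; pose d := b - A (primal_point l).
suff d0 : vecdot d d <= 0.
  by apply/esym/eqP; rewrite -subr_eq0 -/d (vecdot_self_eq0 d0).
pose P t := primal_point (l + t *: d).
pose h t := vecdot b d - symdot (P t) (As d).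
have h0 : h 0 = vecdot d d.
  by rewrite /h /P scale0r addr0 -adjA -vecdotBl.
(* The supergradient at [l + t *: d] bounds the value at [l] by the value at [l + t *: d] minus
   [t * h t]. *)
have hle t : 0 < t -> h t <= 0.
  move=> t0; have := dual_value_supergradient l (l + t *: d).
  have -> : l - (l + t *: d) = (- t) *: d.
    by rewrite opprD addrA subrr add0r scaleNr.
  rewrite vecdotZr mulNr => /le_trans/(_ (lerD (lmax _) (lexx _))).
  by rewrite lerDl oppr_ge0 pmulr_rle0 // vecdotBl adjA.
have lc k : continuous (fun t : R => (l + t *: d) k 0).
  have -> : (fun t : R => (l + t *: d) k 0) = (fun t => l k 0 + t * d k 0).
    by apply/funext => t; rewrite !mxE.
  move=> u; apply: cvgD; first exact: cvg_cst.
  by apply: cvgM; [exact: cvg_id | exact: cvg_cst].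
have hc : {for 0, continuous h}.
  apply: cvgB; first exact: cvg_cst.
  apply: (@continuous_trace_mul _ _ R (fun t => P t : 'M[R]_n)
    (fun=> As d : 'M[R]_n)) => [|i j s]; last exact: cvg_cst.
  exact/continuous_exp_symmx/continuous_exponent.
rewrite -h0 leNgt; apply/negP => hpos.
have /nbhs_ballP[e /= e0 eh] : \forall t \near 0, 0 < h t.
  exact: (@cvgr_gt _ _ _ _ h (h 0) hc 0 hpos).
have : 0 < h (e / 2).
  apply: eh; rewrite /ball /= sub0r normrN gtr0_norm ?divr_gt0 //.
  by rewrite ltr_pdivrMr //; lra.
by rewrite ltNge hle // divr_gt0.
Qed.

(** In vectorised coordinates [As] is a matrix [L] of full row rank; a right inverse [P] recovers
    [l] from the entries of [As l], and [K] sums the absolute entries of [P]. *)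
Lemma linear_injective_bound :
  (forall l, As l = 0 -> l = 0) ->
  exists2 K, 0 <= K & forall l (B : R), (forall i j, `|As l i j| <= B) ->
    forall k, `|l k 0| <= B * K.
Proof.
move=> As0; pose L : 'M[R]_(m, n * n) := \matrix_k mxvec (As (delta_mx k 0)).
have LE l : mxvec (As l) = l^T *m L.
  rewrite {1}(matrix_sum_delta l) exchange_big big_ord1 linear_sum /=.
  rewrite symmx_val_sum linear_sum mulmx_sum_row; apply: eq_bigr => k _.
  by rewrite linearZ symmx_valZ linearZ rowK mxE.
have /row_freeP[P LP] : row_free L.
  rewrite -kermx_eq0; apply/rowV0P => u /sub_kermxP uL.
  have : As u^T = 0.
    apply/val_inj/(can_inj mxvecK); rewrite LE trmxK uL.
    by rewrite (raddf0 (\val : symmx R n -> _)) linear0.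
  by move/As0/(congr1 trmx); rewrite trmxK trmx0.
exists (\sum_q \sum_k `|P q k|) => [|l B AB k].
  by do 2![apply: sumr_ge0 => ? _].
have -> : l k 0 = (mxvec (As l) *m P) 0 k by rewrite LE -mulmxA LP mulmx1 mxE.
rewrite mxE; apply: le_trans (ler_norm_sum _ _ _) _; rewrite mulr_sumr.
apply: ler_sum => q _; rewrite normrM.
case/mxvec_indexP: q => i j; rewrite mxvecE.
rewrite ler_pM // (bigD1 k) //= lerDl; exact: sumr_ge0.
Qed.

(** As [A X0 = b], the dual value is a constant plus [eps] times the quantity bounded in
    [exp_coercive]. A lower bound on it therefore bounds the entries of [exponent l], then those of
    [As l], and by injectivity [l]. *)
Lemma dual_value_coercive : (forall l, As l = 0 -> l = 0) ->
    (exists X0, feasible A b X0 /\ pd X0) ->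
  exists B, forall l, dual_value 0 <= dual_value l -> forall k, `|l k 0| <= B.
Proof.
move=> As0 [X0 [[AX0 _] X0pd]].
have [K K0 HK] := linear_injective_bound As0.
have [delta delta0 [K' HK']] := exp_coercive X0pd.
pose c := \sum_i \sum_j `|C i j|.
(* The quotient bounds the entries of [eps *: exponent l], and [c] those of [C]. *)
pose B1 := (symdot X0 C + eps * K' - dual_value 0) / delta + c.
exists (B1 * K) => l gl; apply: HK => i j.
have Cc : `|C i j| <= c.
  rewrite /c (bigD1 i) //= (bigD1 j) //= -addrA lerDl addr_ge0 ?sumr_ge0 //.
  by move=> ? _; apply: sumr_ge0.
have AsE : As l i j = eps * exponent l i j + C i j.
  rewrite /exponent symmx_valZ symmx_valB 3!mxE mulrA mulfV ?gt_eqF //.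
  by rewrite mul1r subrK.
rewrite AsE; apply: le_trans (ler_normD _ _) _; apply: lerD Cc.
rewrite normrM gtr0_norm // ler_pdivlMr // mulrAC -mulrA.
have gE : dual_value l = symdot X0 C +
    eps * (symdot X0 (exponent l) - \tr (primal_point l : 'M[R]_n)).
  rewrite mulrBr symdot_exponent symdotBr -adjA AX0 /dual_value; ring.
move: gl; rewrite gE => gl.
have := HK' (exponent l) i j; rewrite -(ler_pM2l eps0) -/(primal_point l).
move: gl; set u := eps * (_ - _); set v := dual_value 0; lra.
Qed.

Lemma dual_value_max : (forall l, As l = 0 -> l = 0) ->
    (exists X0, feasible A b X0 /\ pd X0) ->
  exists l, forall l', dual_value l' <= dual_value l.
Proof.
move=> As0 sX0; have [B HB] := dual_value_coercive As0 sX0.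
(* Transposed to row vectors, the form that [EVT_max_rV] takes. Coercivity bounds the superlevel set
   [S] and continuity closes it; off [S] the value is at most [g 0]. *)
pose g (r : 'rV[R]_m) := dual_value r^T.
have tc k : continuous (fun r : 'rV[R]_m => r^T k 0).
  have -> : (fun r : 'rV[R]_m => r^T k 0) = (fun r => r 0 k).
    by apply/funext => r; rewrite mxE.
  exact: coord_continuous.
have gc : continuous g := continuous_dual_value tc.
pose S := [set r | g 0 <= g r].
have SB r : S r -> `|r| <= `|B|.
  rewrite /S /= /g trmx0 => /HB rB; rewrite [leLHS]/Num.Def.normr /= mx_normrE.
  apply/bigmax_leP; split => // -[i k] _ /=; rewrite ord1.
  by have := rB k; rewrite mxE => /le_trans; apply; exact: ler_norm.
have cS : compact S.
  apply: bounded_closed_compact.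
    exists `|B|; split; first exact: normr_real.
    by move=> x /ltW Bx r /SB /le_trans; apply.
  exact: (@preimage_closed _ _ g [set x | g 0 <= x]
    (fun r _ => gc r) (@closed_ge _ _)).
have [r rS rmax] := EVT_max_rV (ex_intro _ 0 (lexx (g 0))) cS
  (continuous_subspaceT gc).
exists r^T => l; have -> : dual_value l = g l^T by rewrite /g trmxK.
change (g l^T <= g r); have /orP[lS|lS] := le_total (g 0) (g l^T).
  exact: rmax (mem_set lS).
exact: le_trans lS (set_mem rS).
Qed.

End Duality.

(** * Strong duality and uniqueness *)

Theorem corollary2p8 (R : realType) (n m : nat) (C : symmx R n)
    (b : 'cV[R]_m) (eps : R) (A : {linear symmx R n -> 'cV[R]_m})
    (As : {linear 'cV[R]_m -> symmx R n}) :
  0 < eps ->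
  is_adjoint A As ->
  compact (feasible A b) ->
  (exists X0, feasible A b X0 /\ pd X0) ->
  (forall l : 'cV[R]_m, As l = 0 -> l = 0) ->
  let rho := optimal_value C A b eps in
  let G := dual_function C As b eps in
  exists Xs : symmx R n,
    [/\ optimal_solution C A b eps Xs,
        forall Y, optimal_solution C A b eps Y -> Y = Xs,
        pd Xs,
        rho = (objective C eps Xs)%:E &
        (exists l, maximizer G l) /\
        forall l, maximizer G l ->
          rho = G l /\ rho = (vecdot b l - eps * \tr (Xs : 'M[R]_n))%:E].
Proof.
move=> eps0 adjA _ sX0 As0 rho G.
pose g := dual_value C b eps As; pose P := primal_point C eps As.
have GE l : G l = (g l)%:E by exact: dual_functionE.
have fP l : (forall l', g l' <= g l) -> feasible A b (P l).
  move=> lmax; split; last exact/pd_psd/pd_exp_symmx.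
  exact: (dual_value_maximizer_feasible eps0 adjA lmax).
have gP l : feasible A b (P l) -> objective C eps (P l) = g l.
  move=> f; rewrite -(lagrangian_feasible _ _ adjA l f).
  by rewrite -dual_value_lagrangian.
have gle X l : feasible A b X -> g l <= objective C eps X.
  move=> f; rewrite -(lagrangian_feasible _ _ adjA l f).
  apply: dual_value_le => //; exact: f.2.
have [l lmax] : exists l, forall l', g l' <= g l.
  exact: dual_value_max eps0 adjA As0 sX0.
have gE l' : g l' = vecdot b l' - eps * \tr (P l' : 'M[R]_n) by [].
have optP : optimal_solution C A b eps (P l).
  by split=> [|Y fY]; [exact: fP | rewrite gP ?gle //; exact: fP].
(* Weak duality gives the reverse inequality, so [X] attains the infimum of the Lagrangian at [l],
   whose minimiser is unique. *)
have uniqP X : feasible A b X -> objective C eps X <= g l -> X = P l.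
  move=> f Xl; apply: (dual_value_eq (b := b) eps0 f.2); apply/eqP.
  rewrite eq_le (lagrangian_feasible _ _ adjA l f) Xl andbT; exact: gle.
have Ppd : pd (P l) by exact: pd_exp_symmx.
clearbody g P.
have rhoE : rho = (objective C eps (P l))%:E.
  exact: ereal_inf_attained optP.1 optP.2.
exists (P l); split => //.
- move=> Y [fY Ymin]; apply: uniqP => //.
  by rewrite -gP; [apply: Ymin|]; exact: fP.
split=> [|l2 G2]; first by exists l => l2; rewrite !GE lee_fin.
have max2 l3 : g l3 <= g l2 by have := G2 l3; rewrite !GE lee_fin.
have gl : g l2 = g l by apply: le_anti; rewrite lmax max2.
(* Every maximizer yields the same primal point, so the trace formula holds for [l2] with the trace
   of [P l]. *)
have P2 : P l2 = P l.
  by apply: uniqP; [exact: fP | rewrite gP ?gl //; exact: fP].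
rewrite rhoE gP; last exact: fP.
by split; [rewrite GE gl | rewrite -P2 -gE gl].
Qed.
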